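(* For each nonnegative integer $k$, \[|\mathcal U_{2k+1}(231,321)|=|\mathcal U_{2k+1}(312,321)|=|\mathcal U_{2k+1}(231,312,321)|=|\mathcal U_{2k+1}(132,231,312)|=1.\] For each $k\ge2$, $\mathcal U_{2k+1}(132,321)=\emptyset$.
   Context: The stack-sorting map $s$ on permutations (finite words of distinct positive integers): $s(\text{empty})=\text{empty}$, and if $\pi=LnR$ with $n$ the largest entry, $s(\pi)=s(L)s(R)n$. A permutation is uniquely sorted if it has exactly one preimage under $s$. A permutation avoids $\tau$ if no subsequence has the same relative order as $\tau$; $\mathcal U_n(\tau^{(1)},\dots,\tau^{(r)})$ is the set of uniquely sorted permutations of $[n]$ avoiding all listed patterns. *)

(* Defs.v *)
From mathcomp Require Import all_boot.
From mathcomp Require Import classical_sets cardinality.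

Set Implicit Arguments.
Unset Strict Implicit.
Unset Printing Implicit Defensive.

Local Open Scope classical_set_scope.

Definition is_permutation (w : seq nat) : Prop :=
  uniq w /\ all (fun x => 0 < x) w.

(* [m] is recursion fuel: any [m >= size w] gives the same result on a
   permutation [w]; the defining equations are [stack_sort_nil] and
   [stack_sort_cat]. *)
Fixpoint stack_sort_rec (m : nat) (w : seq nat) : seq nat :=
  if m isn't m'.+1 then [::] else
  if w is [::] then [::] else
  let n := \max_(x <- w) x in
  let i := index n w in
  stack_sort_rec m' (take i w) ++ stack_sort_rec m' (drop i.+1 w) ++ [:: n].

Definition stack_sort (w : seq nat) : seq nat := stack_sort_rec (size w) w.

Lemma stack_sort_rec_cat m n L R :
  all (fun x => x < n) L -> all (fun x => x < n) R ->
  stack_sort_rec m.+1 (L ++ n :: R) =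
  stack_sort_rec m L ++ stack_sort_rec m R ++ [:: n].
Proof.
move=> ltL ltR.
have maxE : \max_(x <- L ++ n :: R) x = n.
  rewrite big_cat big_cons /= maxnCA; apply/maxn_idPl.
  rewrite geq_max; apply/andP; split; apply/bigmax_leqP_seq => x xs _.
    exact/ltnW/(allP ltL).
  exact/ltnW/(allP ltR).
have nL : n \notin L by apply/negP => /(allP ltL); rewrite ltnn.
have idx : index n (L ++ n :: R) = size L.
  by rewrite index_cat (negbTE nL) /= eqxx addn0.
have -> : stack_sort_rec m.+1 (L ++ n :: R) =
    let k := \max_(x <- L ++ n :: R) x in
    let i := index k (L ++ n :: R) in
    stack_sort_rec m (take i (L ++ n :: R)) ++
    stack_sort_rec m (drop i.+1 (L ++ n :: R)) ++ [:: k].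
  by case: (L).
rewrite /= maxE idx take_size_cat //.
by rewrite -(cat_rcons n L R) drop_size_cat ?size_rcons.
Qed.

Lemma max_split (w : seq nat) : uniq w -> w != [::] ->
  exists n L R, [/\ w = L ++ n :: R, all (fun x => x < n) L
                  & all (fun x => x < n) R].
Proof.
move=> Uw w0.
have nw : \max_(x <- w) x \in w.
  case: w w0 {Uw} => // a w _; elim: w a => [|b w IH] a.
    by rewrite big_seq1 mem_seq1.
  rewrite big_cons; case: leqP => _; last by rewrite mem_head.
  by rewrite inE IH orbT.
have le x : x \in w -> x <= \max_(y <- w) y.
  by move=> xw; exact: (@leq_bigmax_seq _ _ xpredT id).
move: nw le Uw; set n := \max_(x <- w) x.
move: n {w0} => n /splitPr[L R] le.
rewrite uniq_catC /= mem_cat negb_or => /andP[/andP[nR nL] _].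
exists n, L, R; split => //; apply/allP => x xs; rewrite ltn_neqAle le ?andbT.
- by apply: contraNneq nL => <-.
- by rewrite mem_cat xs.
- by apply: contraNneq nR => <-.
- by rewrite mem_cat inE xs !orbT.
Qed.

Lemma stack_sort_rec_fuel m w :
  uniq w -> size w <= m -> stack_sort_rec m w = stack_sort w.
Proof.
rewrite /stack_sort.
have [k lek] := ubnP (size w); elim: k m w lek => // k IH m w lek Uw lem.
have [->|/(max_split Uw)[n [L [R [wE ltL ltR]]]]] := eqVneq w [::].
  by case: (m).
have szw : size w = (size L + size R).+1 by rewrite wE size_cat addnS.
move: Uw; rewrite wE cat_uniq => /and3P[UL _ /andP[_ UR]]; rewrite -wE szw.
move: lek lem; rewrite szw ltnS wE; case: m => // m lek; rewrite ltnS => lem.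
have [szL szR] := (leq_addr (size R) (size L), leq_addl (size L) (size R)).
have [ltL' ltR'] := (leq_ltn_trans szL lek, leq_ltn_trans szR lek).
have [leL leR] := (leq_trans szL lem, leq_trans szR lem).
by rewrite !stack_sort_rec_cat // (IH m L) ?(IH m R) ?(IH (size L + size R) L)
  ?(IH (size L + size R) R).
Qed.

Lemma stack_sort_nil : stack_sort [::] = [::].
Proof. by []. Qed.

Lemma stack_sort_cat n L R : uniq (L ++ R) ->
  all (fun x => x < n) L -> all (fun x => x < n) R ->
  stack_sort (L ++ n :: R) = stack_sort L ++ stack_sort R ++ [:: n].
Proof.
rewrite cat_uniq => /and3P[UL _ UR] ltL ltR.
rewrite {1}/stack_sort size_cat /= addnS stack_sort_rec_cat //.
by rewrite !stack_sort_rec_fuel ?leq_addr ?leq_addl.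
Qed.

Definition uniquely_sorted (p : seq nat) : Prop :=
  exists! w, is_permutation w /\ stack_sort w = p.

Definition same_relative_order (u v : seq nat) : Prop :=
  size u = size v /\
  forall i j, i < size u -> j < size u ->
    (nth 0 u i < nth 0 u j) = (nth 0 v i < nth 0 v j).

Definition avoids (p tau : seq nat) : Prop :=
  forall q, subseq q p -> ~ same_relative_order q tau.

Definition uniquely_sorted_av (n : nat) (taus : seq (seq nat)) : set (seq nat) :=
  [set p | [/\ perm_eq p (iota 1 n), uniquely_sorted p
             & forall tau, tau \in taus -> avoids p tau]].

(* Main.v *)
Require Import Defs.
From mathcomp Require Import all_boot zify.
From mathcomp Require Import classical_sets cardinality.

(* Let [w] be the only preimage of [p], seen as a decreasing binary tree whose
   postorder reading is [p].  No node of [w] has an only child, since the child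
   could be moved to the other side, and reading the tree there is a descent
   between the two subtrees of each node, since otherwise the left subtree could
   be hung below the first leaf of the right one.  Hence [p] splits recursively
   as [p1 ++ p2 ++ [:: n]] with a descent between [p1] and [p2].  If [p] avoids
   321 and one of 231 and 312, this recursion forces p = 2 1 4 3 6 5 ... (2k+1);
   if [p] avoids 132, 231 and 312, [p1] is a singleton at each step, which forces
   p = (k+1) k ... 1 (k+2) ... (2k+1); if [p] avoids 132 and 321, [p1] is again
   a singleton, and the recursion stops at length 3.  The preimages of the two
   words are determined from the right: s(L) and s(R) end with their maxima, and
   the image of a word of length m has at most (m-1)/2 descents. *)

Set Implicit Arguments.
Unset Strict Implicit.
Unset Printing Implicit Defensive.

Implicit Types (n x y : nat) (w p q L R : seq nat).

(** * Induction along the decreasing binary tree of a word *)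

Lemma uniq_max_ind (P : seq nat -> Prop) :
  P [::] ->
  (forall n L R, uniq (L ++ n :: R) ->
     all (fun x => x < n) L -> all (fun x => x < n) R ->
     P L -> P R -> P (L ++ n :: R)) ->
  forall w, uniq w -> P w.
Proof.
move=> P0 Pmax w; have [k] := ubnP (size w).
elim: k w => // k IH w szw Uw.
have [->//|/(max_split Uw)[n [L [R [wE ltL ltR]]]]] := eqVneq w [::].
move: Uw szw; rewrite wE => Uw; rewrite size_cat /= => szw.
move: (Uw); rewrite cat_uniq /= => /and4P[UL _ _ UR].
by apply: Pmax => //; apply: IH => //; lia.
Qed.

Lemma uniq_cat_cons (n : nat) L R :
  uniq (L ++ n :: R) -> [/\ uniq L, uniq R & uniq (L ++ R)].
Proof.
move=> U; have ULR : uniq (L ++ R).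
  by apply: subseq_uniq U; rewrite cat_subseq ?subseq_cons.
by split=> //; move: ULR; rewrite cat_uniq => /and3P[].
Qed.

Lemma perm_stack_sort w : uniq w -> perm_eq (stack_sort w) w.
Proof.
move: w; apply: uniq_max_ind => // n L R U ltL ltR permL permR.
have [_ _ ULR] := uniq_cat_cons U.
by rewrite stack_sort_cat // perm_cat // cats1 perm_rcons perm_cons.
Qed.

(* [f] is the first leaf of the decreasing tree of [R] in postorder, and [L] is
   inserted as the left subtree of that leaf. *)
Lemma stack_sort_insert R : uniq R -> R != [::] ->
  exists f t C D, [/\ R = C ++ f :: D, stack_sort R = f :: t
    & forall L, uniq (L ++ R) -> all (fun x => x < f) L ->
        stack_sort (C ++ L ++ f :: D) = stack_sort L ++ stack_sort R].
Proof.
move: R; apply: uniq_max_ind => // n R1 R2 U lt1 lt2 IH1 IH2 _.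
have [U1 U2 U12] := uniq_cat_cons U.
have sE := stack_sort_cat U12 lt1 lt2.
(* The first leaf lies in the left subtree if there is one, else in the right subtree, and is the
   root [n] if both are empty. *)
have [R1E|/IH1[f [t [C [D [R1E s1 ins]]]]]] := eqVneq R1 [::]; last first.
  exists f, (t ++ stack_sort R2 ++ [:: n]), C, (D ++ n :: R2).
  rewrite sE s1; split=> [||L UL ltL] //; first by rewrite R1E -catA.
  have -> : C ++ L ++ (f :: D) ++ n :: R2 = (C ++ L ++ f :: D) ++ n :: R2.
    by rewrite -!catA.
  have fn : f < n by move: lt1; rewrite R1E all_cat /= => /and3P[].
  have perm1 : perm_eq (C ++ L ++ f :: D) (L ++ R1).
    by rewrite R1E perm_catCA.
  have ULR : uniq ((L ++ R1) ++ R2).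
    by move: UL; rewrite catA => /uniq_cat_cons[].
  rewrite stack_sort_cat //.
  - rewrite ins ?s1 -?catA //.
    by move: ULR; rewrite cat_uniq => /and3P[].
  - by rewrite (perm_uniq (perm_cat perm1 (perm_refl R2))).
  - rewrite (perm_all _ perm1) all_cat lt1 andbT.
    by apply: sub_all ltL => x xf; exact: ltn_trans fn.
subst R1; have [R2E|/IH2[f [t [C [D [R2E s2 ins]]]]]] := eqVneq R2 [::].
  subst R2; exists n, [::], [::], [::]; split => // L UL ltL.
  rewrite sE stack_sort_cat // cats0.
  by move: UL; rewrite cat_uniq => /andP[].
exists f, (t ++ [:: n]), (n :: C), D.
rewrite sE s2; split=> [||L UL ltL] //; first by rewrite R2E.
have fn : f < n by move: lt2; rewrite R2E all_cat /= => /and3P[].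
have perm2 : perm_eq (C ++ L ++ f :: D) (L ++ R2) by rewrite R2E perm_catCA.
have [_ _ ULR] := uniq_cat_cons UL.
have -> : (n :: C) ++ L ++ f :: D = [::] ++ n :: (C ++ L ++ f :: D) by [].
rewrite stack_sort_cat ?(perm_uniq perm2) //.
- by rewrite ins // s2 -catA.
- rewrite (perm_all _ perm2) all_cat lt2 andbT.
  by apply: sub_all ltL => x xf; exact: ltn_trans fn.
Qed.

(** * Shape of uniquely sorted words *)

Lemma is_permutation_perm w p :
  perm_eq w p -> is_permutation w -> is_permutation p.
Proof.
by move=> wp; rewrite /is_permutation (perm_uniq wp) (perm_all _ wp).
Qed.

(* The shape of a uniquely sorted word: in the decreasing binary tree of its
   preimage every node has zero or two children, and postorder reading has a
   descent at the junction of the two subtrees of each node. *)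
Inductive full_sorted : seq nat -> Prop :=
| full_sorted1 x : full_sorted [:: x]
| full_sorted_node A x y B n :
    full_sorted (rcons A x) -> full_sorted (y :: B) -> y < x ->
    all (fun z => z < n) (A ++ x :: y :: B) ->
    full_sorted (A ++ x :: y :: rcons B n).

Lemma uniquely_sorted_full p :
  uniquely_sorted p -> p != [::] -> full_sorted p.
Proof.
have [k] := ubnP (size p).
elim: k p => // k IH p szp [w [[Pw wp] wuniq]] p0.
have [Uw posw] := Pw.
have w0 : w != [::] by apply: contraNneq p0 => w0; rewrite -wp w0.
have [n [L [R [wE ltL ltR]]]] := max_split Uw w0.
have [UL UR ULR] : [/\ uniq L, uniq R & uniq (L ++ R)].
  by apply: (@uniq_cat_cons n); rewrite -wE.
have pE : p = stack_sort L ++ stack_sort R ++ [:: n].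
  by rewrite -wp wE stack_sort_cat.
have preimage w' : perm_eq w w' -> stack_sort w' = p -> w = w'.
  by move=> ww' sw'; apply: wuniq; split => //; exact: is_permutation_perm Pw.
have [permL permR] := (perm_stack_sort UL, perm_stack_sort UR).
have [szL szR] := (perm_size permL, perm_size permR).
have szLR : size L + size R < k.
  by move: szp; rewrite pE !size_cat szL szR /=; lia.
(* Uniqueness passes to both subtrees: another preimage of [stack_sort L] or of [stack_sort R] could
   be substituted in [w]. *)
have usL : uniquely_sorted (stack_sort L).
  exists L; split=> [|L' [[UL' posL'] sL']].
    split=> //; split=> //.
    by move: posw; rewrite wE all_cat => /andP[].
  have permL' : perm_eq L L'.
    by rewrite perm_sym -(permPr permL) -sL' perm_sym perm_stack_sort.
  have : w = L' ++ n :: R.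
    apply: preimage; first by rewrite wE perm_cat2r.
    rewrite stack_sort_cat -?(perm_all _ permL') ?sL' //.
    by rewrite -(perm_uniq (perm_cat permL' (perm_refl R))).
  rewrite wE => /eqP; rewrite eqseq_cat ?(perm_size permL') //.
  by case/andP=> /eqP.
have usR : uniquely_sorted (stack_sort R).
  exists R; split=> [|R' [[UR' posR'] sR']].
    split=> //; split=> //.
    by move: posw; rewrite wE all_cat /= => /and3P[].
  have permR' : perm_eq R R'.
    by rewrite perm_sym -(permPr permR) -sR' perm_sym perm_stack_sort.
  have : w = L ++ n :: R'.
    apply: preimage; first by rewrite wE perm_cat2l perm_cons.
    rewrite stack_sort_cat -?(perm_all _ permR') ?sR' //.
    by rewrite -(perm_uniq (perm_cat (perm_refl L) permR')).
  by rewrite wE => /eqP; rewrite eqseq_cat // eqxx => /eqP[].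
have [L0|L0] := eqVneq L [::]; have [R0|R0] := eqVneq R [::].
- by rewrite pE L0 R0; exact: full_sorted1.
- (* An only child may be moved to the other side. *)
  have : w = R ++ n :: [::].
    apply: preimage; first by rewrite wE L0 /= perm_sym perm_catC.
    by rewrite stack_sort_cat ?cats0 // pE L0.
  case: R R0 ltR wE {UR ULR pE permR szR szLR usR} => // r R _ ltR.
  by rewrite L0 => -> [rn]; move: ltR; rewrite rn /= ltnn.
- have : w = [::] ++ n :: L.
    apply: preimage; first by rewrite wE R0 perm_catC.
    by rewrite stack_sort_cat // pE R0.
  case: L L0 ltL wE {UL ULR pE permL szL szLR usL} => // l L _ ltL.
  by rewrite R0 => -> [ln]; move: ltL; rewrite ln /= ltnn.
have fL : full_sorted (stack_sort L).
  apply: IH => //; first by rewrite szL (leq_ltn_trans (leq_addr _ _) szLR).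
  by rewrite -size_eq0 szL size_eq0.
have fR : full_sorted (stack_sort R).
  apply: IH => //; first by rewrite szR (leq_ltn_trans (leq_addl _ _) szLR).
  by rewrite -size_eq0 szR size_eq0.
(* At the junction the maximum [x] of [L], which ends [stack_sort L], meets the first leaf [y] of
   [R], which begins [stack_sort R]. *)
have [y [B [C [D [RE sR ins]]]]] := stack_sort_insert UR R0.
have [x [L1 [L2 [LE lt1 lt2]]]] := max_split UL L0.
have [_ _ UL12] : [/\ uniq L1, uniq L2 & uniq (L1 ++ L2)].
  by apply: (@uniq_cat_cons x); rewrite -LE.
have sL : stack_sort L = rcons (stack_sort L1 ++ stack_sort L2) x.
  by rewrite LE stack_sort_cat // -cats1 catA.
have xy : x != y.
  apply: contraTneq ULR => xy; rewrite cat_uniq negb_and; apply/orP; right.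
  rewrite negb_and; apply/orP; left; rewrite negbK; apply/hasP.
  exists x; first by rewrite RE xy mem_cat mem_head orbT.
  by rewrite /= LE mem_cat mem_head orbT.
have [yx|yx] := ltnP y x.
  rewrite pE sR sL cat_rcons cats1 /=; apply: full_sorted_node => //.
  - by rewrite -sL.
  - by rewrite -sR.
  rewrite -cat_rcons -sL -sR all_cat (perm_all _ permL) (perm_all _ permR).
  by rewrite ltL.
(* At an ascent the left subtree may be hung below the first leaf, in
   postorder, of the right subtree. *)
have ltLy : all (fun z => z < y) L.
  have ltxy : x < y by rewrite ltn_neqAle xy.
  rewrite LE all_cat /= ltxy; apply/andP; split.
    by apply: sub_all lt1 => z zx; exact: ltn_trans ltxy.
  by apply: sub_all lt2 => z zx; exact: ltn_trans ltxy.
have permI : perm_eq (C ++ L ++ y :: D) (L ++ R) by rewrite RE perm_catCA.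
have : w = (C ++ L ++ y :: D) ++ n :: [::].
  apply: preimage.
    rewrite wE (permPr (perm_cat permI (perm_refl [:: n]))) -catA perm_cat2l.
    by rewrite cats1 perm_sym perm_rcons.
  rewrite stack_sort_cat ?cats0 ?(perm_uniq permI) ?ins //.
  - by rewrite pE -catA.
  - by rewrite (perm_all _ permI) all_cat ltL.
(* The rearranged preimage ends with [n], while [w] ends with the last letter of [R], which is
   smaller. *)
move=> /(congr1 (last 0)); rewrite wE RE !last_cat /= !last_cat /= => Dn.
suff : n \in R by move/(allP ltR); rewrite ltnn.
by rewrite RE -Dn mem_cat mem_last orbT.
Qed.

(** * Patterns of length three *)

(** For a concrete pattern, this puts avoidance in a form that [lia] can decide; comparisons of a
    position with itself are false on both sides. *)
Lemma avoids3 p d e f a b c :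
  avoids p [:: d; e; f] -> subseq [:: a; b; c] p ->
  ~~ [&& (a < b) == (d < e), (a < c) == (d < f), (b < c) == (e < f),
         (b < a) == (e < d), (c < a) == (f < d) & (c < b) == (f < e)].
Proof.
move=> av sub; apply/negP => /and5P[/eqP ab /eqP ac /eqP bc /eqP ba].
case/andP=> /eqP ca /eqP cb; apply: (av _ sub); split=> //.
by case=> [|[|[|?]]] [|[|[|?]]] //= _ _; rewrite !ltnn.
Qed.

Lemma same_relative_order3 q d e f : same_relative_order q [:: d; e; f] ->
  exists a b c, [/\ q = [:: a; b; c], (a < b) = (d < e), (b < c) = (e < f)
                  & (c < a) = (f < d)].
Proof.
case: q => [|a [|b [|c [|? ?]]]] [//= _ H]; exists a, b, c.
by split=> //; [apply: (H 0 1) | apply: (H 1 2) | apply: (H 2 0)].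
Qed.

Lemma subseq_cons_cat (x : nat) s P Q :
  subseq s Q -> subseq (x :: s) (P ++ x :: Q).
Proof.
by move=> sQ; rewrite -[x :: s]cat0s cat_subseq ?sub0seq //= eqxx.
Qed.

(** * Avoiding 321 together with 231 or 312 *)

(** These are the words order-isomorphic to 2 1 4 3 ... (2k) (2k-1) (2k+1). *)
Inductive layered : seq nat -> Prop :=
| layered1 x : layered [:: x]
| layered_cons a b q :
    b < a -> all (fun z => a < z) q -> layered q -> layered (a :: b :: q).

(** By induction on the left part, whose two-letter blocks are peeled off one at a time until only
    [x] remains. *)
Lemma layered_node A x y B n :
  layered (rcons A x) -> layered (y :: B) -> y < x ->
  all (fun z => z < n) (A ++ x :: y :: B) -> uniq (A ++ x :: y :: B) ->
  avoids (A ++ x :: y :: rcons B n) [:: 3; 2; 1] ->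
  avoids (A ++ x :: y :: rcons B n) [:: 2; 3; 1] \/
  avoids (A ++ x :: y :: rcons B n) [:: 3; 1; 2] ->
  layered (A ++ x :: y :: rcons B n).
Proof.
move=> lA lB yx lt_n Un av321 av.
have {}av321 a b c :
    subseq [:: a; b; c] (A ++ x :: y :: rcons B n) -> b < a -> b <= c.
  by move=> /(avoids3 av321) /=; lia.
have {}av : (forall a b c, subseq [:: a; b; c] (A ++ x :: y :: rcons B n) ->
      a < b -> a <= c) \/
    (forall a b c, subseq [:: a; b; c] (A ++ x :: y :: rcons B n) ->
      b < c -> c < a -> False).
  case: av => av; [left | right] => a b c /(avoids3 av) /=; lia.
have [m szA] := ubnP (size A).
elim: m A szA lA lt_n Un av321 av => // m IH A szA lA lt_n Un av321 av.
case: A szA lA lt_n Un av321 av => [|a [|b A]] /= szA lA lt_n Un av321 av.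
(* If the right part had a second letter [b], it would begin with a descent, and [x y b] would be a
   321. *)
- case: B lB lt_n Un av321 av {IH} => [|b B] lB /= lt_n Un av321 av.
    by apply: layered_cons => //=; [lia | exact: layered1].
  have ltby : b < y by inversion lB.
  have := av321 x y b; rewrite !eqxx sub0seq => /(_ isT yx).
  by rewrite leqNgt ltby.
- by inversion lA as [|? ? ? ? ? lnil]; inversion lnil.
inversion lA as [|a' b' q ba allA lA']; subst.
apply: layered_cons => //.
  apply/allP => z; rewrite mem_cat !inE mem_rcons inE => zin.
  have [/(allP allA)//|zA] := boolP (z \in rcons A x).
  move: zA; rewrite mem_rcons inE negb_or => /andP[zx zA].
  move: zin; rewrite (negbTE zA) (negbTE zx) /= => zin.
  have [->|zn] := eqVneq z n; first by case/andP: lt_n.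
  have {zn}zB : z \in y :: B by rewrite inE; move: zin; rewrite (negbTE zn).
  have zin' : z \in y :: rcons B n.
    by rewrite -rcons_cons mem_rcons inE zB orbT.
  have zAB : z \in A ++ x :: y :: B by rewrite mem_cat 2!inE -in_cons zB !orbT.
  have za : z != a.
    by apply: contraTneq Un => <-; rewrite inE zAB orbT.
  have zb : z != b.
    by apply: contraTneq Un => <-; rewrite zAB andbF.
  have ax : a < x by apply: (allP allA); rewrite mem_rcons mem_head.
  rewrite ltn_neqAle eq_sym za /= leqNgt; apply/negP => lt_za.
  (* If [z < a], then [a x z] is a 231, and [a b z] is a 321 or a 312. *)
  case: av => av.
    have /av : subseq [:: a; x; z] [:: a, b & A ++ x :: y :: rcons B n].
      rewrite -[[:: a, b & _]]/([::] ++ a :: (b :: A) ++ _).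
      by do 2!apply: subseq_cons_cat; rewrite sub1seq.
    by move=> /(_ ax); lia.
  have sub : subseq [:: a; b; z] [:: a, b & A ++ x :: y :: rcons B n].
    by rewrite /= !eqxx sub1seq mem_cat inE zin' !orbT.
  by have := av321 _ _ _ sub ba; have := av _ _ _ sub; lia.
have sub s : subseq s (A ++ x :: y :: rcons B n) ->
    subseq s [:: a, b & A ++ x :: y :: rcons B n].
  by move/subseq_trans; apply; exact: (suffix_subseq [:: a; b]).
apply: IH => //.
- by lia.
- by case/and3P: lt_n.
- by case/and3P: Un.
- by move=> ? ? ? /sub /av321.
- by case: av => av; [left | right] => ? ? ? /sub /av.
Qed.

Lemma full_sorted_layered p : full_sorted p -> uniq p ->
  avoids p [:: 3; 2; 1] -> avoids p [:: 2; 3; 1] \/ avoids p [:: 3; 1; 2] ->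
  layered p.
Proof.
elim=> {p} [x|A x y B n _ IHA _ IHB yx lt_n] Up av321 av; first exact: layered1.
have avoids_sub p q t : subseq p q -> avoids q t -> avoids p t.
  by move=> pq avq r rp; apply: avq; exact: subseq_trans pq.
have pE : A ++ x :: y :: rcons B n = rcons A x ++ rcons (y :: B) n.
  by rewrite cat_rcons.
have subA : subseq (rcons A x) (A ++ x :: y :: rcons B n).
  by rewrite pE prefix_subseq.
have subB : subseq (y :: B) (A ++ x :: y :: rcons B n).
  rewrite pE; apply: subseq_trans (suffix_subseq _ _).
  exact: subseq_rcons.
have UAB : uniq (A ++ x :: y :: B).
  move: Up; rewrite pE -rcons_cat rcons_uniq => /andP[_].
  by rewrite cat_rcons.
apply: layered_node => //.
- apply: IHA; rewrite ?(subseq_uniq subA) //; first exact: avoids_sub av321.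
  by case: av => av; [left | right]; exact: avoids_sub av.
- apply: IHB; rewrite ?(subseq_uniq subB) //; first exact: avoids_sub av321.
  by case: av => av; [left | right]; exact: avoids_sub av.
Qed.

(** The second letter is the minimum, and the first is the minimum of what remains, so the set of
    letters determines the first block. *)
Lemma layered_perm_inj p q : layered p -> layered q -> perm_eq p q -> p = q.
Proof.
have le_min (a b : nat) r z : b < a -> all (fun u => a < u) r ->
    z \in a :: b :: r -> b <= z.
  by move=> ba ltr; rewrite !inE => /or3P[/eqP->|/eqP->|/(allP ltr)]; lia.
have le_snd (a : nat) r z : all (fun u => a < u) r -> z \in a :: r -> a <= z.
  by move=> ltr; rewrite inE => /orP[/eqP->|/(allP ltr)/ltnW].
move=> lp; elim: lp q => {p} [x|a b p ba ltp _ IH] q [y|c d r dc ltr lr] peq.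
- by have := perm_mem peq x; rewrite !inE eqxx => /esym/eqP->.
- by have := perm_size peq.
- by have := perm_size peq.
have bd : b = d.
  apply/eqP; rewrite eqn_leq (le_min a b p) ?(le_min c d r) //.
    by rewrite -(perm_mem peq) !inE eqxx orbT.
  by rewrite (perm_mem peq) !inE eqxx orbT.
subst d.
have {}peq : perm_eq (a :: p) (c :: r).
  have swap (u v : nat) s : perm_eq (u :: v :: s) (v :: u :: s).
    exact/permPl/(perm_catCA [:: u] [:: v]).
  by rewrite -(perm_cons b) (perm_trans (swap _ _ _)) // (perm_trans peq).
have ac : a = c.
  apply/eqP; rewrite eqn_leq (le_snd a p) ?(le_snd c r) //.
    by rewrite -(perm_mem peq) mem_head.
  by rewrite (perm_mem peq) mem_head.
by subst c; rewrite perm_cons in peq; rewrite (IH r).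
Qed.

(** Blocks have at most two letters, so the first and third letters lie in different blocks, and
    blocks increase. This excludes 231, 312 and 321 at once. *)
Lemma layered_subseq3 p a b c : layered p -> subseq [:: a; b; c] p -> a < c.
Proof.
elim=> {p} [x|u v p vu ltp _ IH]; first by rewrite /=; case: ifP.
rewrite [subseq _ _]/=; case: eqP => [->|_].
  move=> sub; apply: (allP ltp); move: sub; rewrite -/(subseq _ _).
  case: eqP => _; first by rewrite sub1seq.
  by move/mem_subseq; apply; rewrite !inE eqxx orbT.
rewrite -/(subseq _ _); case: eqP => [->|_ /IH//] sub.
apply: ltn_trans vu _; apply: (allP ltp).
by apply: (mem_subseq sub); rewrite !inE eqxx orbT.
Qed.

Lemma layered_avoids p d e f : layered p -> f < d -> avoids p [:: d; e; f].
Proof.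
move=> lp fd q qp /same_relative_order3[a [b [c [qE _ _]]]].
by rewrite fd; subst q; have := layered_subseq3 lp qp; lia.
Qed.

(** [layered] peels blocks off the front, whereas preimages are determined from the back; this gives
    the recursion at the back. *)
Lemma layered_last2 p : layered p -> 1 < size p ->
  exists q x y n, [/\ p = q ++ [:: x; y; n], layered (rcons q x), y < x,
    x < n & all (fun z => z < n) q].
Proof.
elim=> {p} // a b p ba ltp lp IH _.
have [|szp] := ltnP 1 (size p).
  move=> /IH[q [x [y [n [pE lq yx xn lt_n]]]]].
  exists (a :: b :: q), x, y, n; rewrite pE; split=> //.
    apply: layered_cons => //; apply/allP => z zq; apply: (allP ltp).
    by rewrite pE -cat_rcons mem_cat zq.
  have an : a < n by apply: (allP ltp); rewrite pE mem_cat !inE eqxx !orbT.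
  by rewrite /= an (ltn_trans ba an).
case: p lp szp ltp {IH} => [|n [|//]] lp _ /=; first by inversion lp.
rewrite andbT => an; exists [::], a, b, n; split=> //; exact: layered1.
Qed.

(** * Unique preimages of layered words *)

Lemma stack_sort1 x : stack_sort [:: x] = [:: x].
Proof. exact: (@stack_sort_cat x [::] [::]). Qed.

Lemma stack_sort_rconsE w p n : uniq w -> stack_sort w = rcons p n ->
  exists L R, [/\ w = L ++ n :: R, all (fun x => x < n) L,
    all (fun x => x < n) R, uniq (L ++ R) & stack_sort L ++ stack_sort R = p].
Proof.
move=> Uw sw.
have w0 : w != [::] by apply/eqP => w0; move: sw; rewrite w0; case: (p).
have [m [L [R [wE ltL ltR]]]] := max_split Uw w0.
have [_ _ ULR] : [/\ uniq L, uniq R & uniq (L ++ R)].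
  by apply: (@uniq_cat_cons m); rewrite -wE.
move: sw; rewrite wE stack_sort_cat // catA cats1 => /rcons_inj[<- mn].
by subst m; exists L, R.
Qed.

Lemma stack_sort_last_max w p n : uniq w -> stack_sort w = rcons p n ->
  all (fun x => x < n) p.
Proof.
move=> Uw /(stack_sort_rconsE Uw)[L [R [_ ltL ltR ULR <-]]].
move: ULR; rewrite cat_uniq => /and3P[UL _ UR].
by rewrite all_cat !(perm_all _ (perm_stack_sort _)) // ltL.
Qed.

Lemma stack_sort_inj1 w x : uniq w -> stack_sort w = [:: x] -> w = [:: x].
Proof.
move=> Uw sw; apply: perm_small_eq => //.
by rewrite -sw perm_sym perm_stack_sort.
Qed.

Lemma uniquely_sorted1 x : 0 < x -> uniquely_sorted [:: x].
Proof.
move=> x0; exists [:: x]; split=> [|w [[Uw _] /(stack_sort_inj1 Uw)->]] //.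
by split; [split; rewrite //= x0 | exact: stack_sort1].
Qed.

(** In a preimage [L ++ n :: R], the images of [L] and [R] concatenate to [q x y]. Each nonempty
    image ends with its maximum, and [y < x], so the cut can only fall just before [y]. *)
Lemma uniquely_sorted_node_leaf q x y n :
  uniquely_sorted (rcons q x) -> uniq (q ++ [:: x; y; n]) -> 0 < y < x ->
  x < n -> all (fun z => z < n) q -> uniquely_sorted (q ++ [:: x; y; n]).
Proof.
move=> [w [[[Uw posw] sw] wuniq]] Uq /andP[y0 yx] xn lt_n.
have permw := perm_stack_sort Uw; rewrite sw in permw.
have Uwy : uniq (w ++ [:: y]).
  rewrite cat_uniq Uw /= orbF andbT -(perm_mem permw).
  by move: Uq; rewrite -cat_rcons cat_uniq /= negb_or => /and3P[_ /andP[]].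
have ltwn : all (fun z => z < n) w by rewrite -(perm_all _ permw) all_rcons xn.
have yn := ltn_trans yx xn.
exists (w ++ [:: n; y]); split.
  split; last first.
    by rewrite stack_sort_cat ?all_seq1 // sw stack_sort1 cat_rcons.
  split; last by rewrite all_cat posw /= y0 (leq_ltn_trans _ xn).
  rewrite -cat_rcons in Uq.
  by rewrite (perm_uniq (perm_cat (_ : perm_eq w (rcons q x))
    (_ : perm_eq _ [:: y; n]))) 1?perm_sym // (perm_catC [:: y] [:: n]).
move=> w' [[Uw' posw']].
rewrite -[[:: x; y; n]]/([:: x; y] ++ [:: n]) catA cats1.
move=> /(stack_sort_rconsE Uw')[L [R [wE _ _ ULR]]].
move: posw'; rewrite wE all_cat => /andP[posL _].
move: ULR; rewrite cat_uniq => /and3P[UL _ UR].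
rewrite -[[:: x; y]]/([:: x] ++ [:: y]) catA !cats1.
(* If [stack_sort R] is empty, [stack_sort L] ends in [x y]; if it has at least two letters, it ends
   in [x y] itself. Neither ends with its maximum. *)
move sR: (stack_sort R) => r0; case/lastP: r0 sR => [|r z] sR.
  rewrite cats0 => /(stack_sort_last_max UL).
  by rewrite all_rcons ltnNge (ltnW yx).
rewrite -rcons_cat => /rcons_inj[+ zy]; subst z.
case: (lastP r) sR => [|r' z] sR.
  by rewrite cats0 (stack_sort_inj1 UR sR) => sL; rewrite (wuniq L).
rewrite -rcons_cat => /rcons_inj[_ zx]; subst z.
have := stack_sort_last_max UR sR.
by rewrite all_rcons ltnNge (ltnW yx).
Qed.

Lemma layered_uniquely_sorted p : layered p -> is_permutation p ->
  uniquely_sorted p.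
Proof.
have [m] := ubnP (size p); elim: m p => // m IH p szp lp [Up posp].
have [le1|/(layered_last2 lp)[q [x [y [n [pE lq yx xn lt_n]]]]]] :=
  leqP (size p) 1.
  case: p lp le1 posp {szp Up} => [|x [|//]] lp _ /=; first by inversion lp.
  by rewrite andbT; exact: uniquely_sorted1.
move: szp Up posp; rewrite pE size_cat all_cat /= => szp Up.
case/and5P=> posq posx posy _ _.
apply: uniquely_sorted_node_leaf; rewrite ?posy //.
apply: IH; rewrite ?size_rcons //; first by lia.
split; last by rewrite all_rcons posx.
by apply: subseq_uniq Up; rewrite -cat_rcons prefix_subseq.
Qed.

(** * Descents, and unique preimages of V-shaped words *)

(** The number of descents: the default [a] of [head] makes the last letter contribute nothing. *)
Fixpoint des p : nat :=
  if p is a :: q then (head a q < a) + des q else 0.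

Lemma des_cat p q :
  des (p ++ q) <= des p + des q + ((p != [::]) && (q != [::])).
Proof.
elim: p => [|a [|b p] IH] /=; first by rewrite addn0.
  by case: q {IH} => [|b q] /=; lia.
by move: IH => /=; lia.
Qed.

Lemma des_rcons_max p n : all (fun x => x < n) p -> des (rcons p n) = des p.
Proof.
elim: p => [|a [|b p] IH] /=; rewrite ?ltnn //.
  by case/andP => an _; lia.
by case/andP=> _ /IH /= ->.
Qed.

Lemma des_rev_cat u v : pairwise ltn u -> (size u).-1 <= des (rev u ++ v).
Proof.
elim/last_ind: u => // u x IH.
rewrite rev_rcons -cats1 pairwise_cat /= => /and3P[ltx Pu _].
rewrite size_cat addn1 /=; have := IH Pu; case/lastP: u ltx {IH Pu} => // u y.
rewrite rev_rcons size_rcons /= => ltx; suff -> : y < x by lia.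
by move: ltx => /allP/(_ y); rewrite mem_rcons mem_head /= andbT; apply.
Qed.

(** The final maximum creates no descent, and the junction creates one only if both subtrees are
    nonempty. Subtrees of sizes l, r >= 1 then give at most (l-1) + (r-1) + 2 = l + r for twice the
    number of descents. *)
Lemma des_stack_sort w : uniq w -> 2 * des (stack_sort w) <= (size w).-1.
Proof.
move: w; apply: uniq_max_ind => // n L R U ltL ltR.
have [UL UR ULR] := uniq_cat_cons U.
rewrite stack_sort_cat // catA cats1 des_rcons_max; last first.
  by rewrite all_cat !(perm_all _ (perm_stack_sort _)) // ltL.
have := des_cat (stack_sort L) (stack_sort R).
rewrite -!size_eq0 !(perm_size (perm_stack_sort _)) // size_cat /=.
by case: (size L) (size R) => [|l] [|r] /=; lia.
Qed.

Lemma pairwise_ltn_rcons p x :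
  pairwise ltn (rcons p x) -> all (fun z => z < x) p.
Proof. by rewrite -cats1 pairwise_cat allrel1r => /andP[]. Qed.

(** By induction, removing the first letter [d] and the last letter [n]: in every preimage the left
    subtree of [n] is the leaf [d], and the right subtree is a preimage of the shorter V. *)
Lemma vee_uniquely_sorted u v : pairwise ltn (u ++ v) ->
  all (fun x => 0 < x) (u ++ v) -> size u = (size v).+1 ->
  uniquely_sorted (rev u ++ v).
Proof.
elim/last_ind: v u => [|v n IH] u.
  case: u => [|x [|//]] //= _; rewrite andbT => x0 _.
  exact: uniquely_sorted1.
case/lastP: u => [|u d]; first by rewrite size_rcons.
rewrite !size_rcons => Puv posuv [szu].
have subuv : subseq (u ++ v) (rcons u d ++ rcons v n).
  by rewrite cat_subseq ?subseq_rcons.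
have Puv' := subseq_pairwise subuv Puv.
have posuv' : all (fun x => 0 < x) (u ++ v).
  by apply/allP => x /(mem_subseq subuv); exact: allP.
have [w [[[Uw posw] sw] wuniq]] := IH u Puv' posuv' szu.
have lt_n : all (fun z => z < n) (d :: rev u ++ v).
  move: Puv; rewrite -rcons_cat => /pairwise_ltn_rcons.
  by rewrite cat_rcons /= !all_cat all_rev /= andbCA.
have [Pud ltd] : pairwise ltn (rcons u d) /\ all (fun z => z < d) u.
  move: Puv; rewrite pairwise_cat => /and3P[_ Pud _].
  by split=> //; exact: pairwise_ltn_rcons.
have Uuv : uniq (d :: rev u ++ v).
  have permuv : perm_eq (u ++ d :: v) (d :: rev u ++ v).
    by rewrite -cat1s perm_catCA /= perm_cons perm_cat2r perm_sym perm_rev.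
  rewrite -(perm_uniq permuv) -cat_rcons.
  by have := pairwise_uniq ltnn Puv; rewrite -rcons_cat rcons_uniq => /andP[].
have permw := perm_stack_sort Uw; rewrite sw in permw.
have pE : rev (rcons u d) ++ rcons v n = rcons (d :: rev u ++ v) n.
  by rewrite rev_rcons -rcons_cat.
have [dn ltwn] : d < n /\ all (fun z => z < n) w.
  by move: lt_n; rewrite /= (perm_all _ permw) => /andP.
have Udw : uniq ([:: d] ++ w).
  by rewrite /= -(perm_mem permw) Uw andbT; case/andP: Uuv.
rewrite pE; exists ([:: d] ++ n :: w); split.
  split; last first.
    by rewrite stack_sort_cat ?all_seq1 // sw stack_sort1 cats1.
  split.
    rewrite /= inE negb_or neq_ltn dn Uw andbT /=.
    case/andP: Udw => /= -> _ /=.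
    by apply/negP => /(allP ltwn); rewrite ltnn.
  have d0 : 0 < d by apply: (allP posuv); rewrite mem_cat mem_rcons mem_head.
  by rewrite /= d0 posw (ltn_trans d0).
move=> w' [[Uw' posw'] /(stack_sort_rconsE Uw')[L [R [wE _ _ ULR]]]].
move: posw'; rewrite wE all_cat /= => /and3P[_ _ posR].
move: ULR; rewrite cat_uniq => /and3P[UL _ UR] sLR.
(* A subtree whose image starts with the whole decreasing run is too small to
   have that many descents. *)
have no_run t X : uniq X -> size t <= size v ->
    stack_sort X = rev (rcons u d) ++ t -> False.
  move=> UX szt sX; have := des_stack_sort UX; rewrite sX.
  have := des_rev_cat t Pud; have := perm_size (perm_stack_sort UX).
  rewrite sX size_cat size_rev size_rcons => <-.
  move: szu szt; move: (des _) (size t) (size u) (size v); clear; lia.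
(* The cases follow the length of [stack_sort L]: empty, [d] alone, or longer; only [d] alone
   survives. *)
move sL: (stack_sort L) sLR => [|z s] /=.
  move=> sR; case: (no_run v R UR) => //.
  by rewrite sR rev_rcons.
case=> zd sE; subst z.
have [s0|s0] := eqVneq s [::].
  move: sE; rewrite s0 /= => sR.
  have LE : L = [:: d] by apply: (stack_sort_inj1 UL); rewrite sL s0.
  by rewrite LE (wuniq R).
have sT : s = take (size s) (rev u ++ v) by rewrite -sE take_size_cat.
(* If the cut falls inside the decreasing run, [stack_sort L] ends below its first letter [d];
   otherwise it contains the whole run. *)
move: sT; rewrite take_cat; case: ltnP => [_|_] sT.
  case/lastP: s s0 sL sT {sE} => // s y _.
  rewrite -rcons_cons => /(stack_sort_last_max UL) /andP[dy _] sT.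
  have : y \in take (size (rcons s y)) (rev u).
    by rewrite -sT mem_rcons mem_head.
  by move=> /mem_take; rewrite mem_rev => /(allP ltd); rewrite ltnNge ltnW.
case: (no_run (take (size s - size (rev u)) v) L UL).
  by rewrite size_take_min geq_minr.
by rewrite sL {1}sT rev_rcons.
Qed.

Lemma vee_subseq2 u v b c : pairwise ltn (u ++ v) ->
  subseq [:: b; c] (rev u ++ v) ->
  ((c < b) && (b \in u)) || ((b < c) && (c \in v)).
Proof.
elim/last_ind: u => [|u x IH].
  move=> Pv sub; have := subseq_pairwise sub Pv.
  rewrite /= !andbT => ->; rewrite andbF /=.
  by apply: (mem_subseq sub); rewrite !inE eqxx orbT.
rewrite cat_rcons => Px; rewrite rev_rcons /=.
move: (Px); rewrite pairwise_cat allrel_consr /=.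
case/and4P=> /andP[ltux ltuv] Pu ltxv Pv.
have Puv : pairwise ltn (u ++ v) by rewrite pairwise_cat ltuv Pu.
case: eqP => [-> | _]; last first.
  move=> /(IH Puv); rewrite mem_rcons inE.
  by case/orP=> /andP[-> ->]; rewrite orbT.
rewrite sub1seq mem_cat mem_rev mem_rcons mem_head andbT.
case/orP=> [/(allP ltux)->//|cv].
by rewrite [x < c](allP ltxv _ cv) cv orbT.
Qed.

(** If the third letter is in [rev u], all three lie in the decreasing run; if it is in [v], it
    exceeds every letter before it. *)
Lemma vee_subseq3 u v a b c : pairwise ltn (u ++ v) ->
  subseq [:: a; b; c] (rev u ++ v) -> (c < b < a) || (maxn a b < c).
Proof.
elim/last_ind: u => [|u x IH].
  move=> Pv sub; have := subseq_pairwise sub Pv.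
  rewrite /= !andbT; lia.
rewrite cat_rcons => Px; rewrite rev_rcons /=.
move: (Px); rewrite pairwise_cat allrel_consr /=.
case/and4P=> /andP[ltux ltuv] Pu ltxv Pv.
have Puv : pairwise ltn (u ++ v) by rewrite pairwise_cat ltuv Pu.
case: eqP => [-> | _ /(IH Puv)//].
move=> /(vee_subseq2 Puv)/orP[/andP[-> /(allP ltux)/=->//]|/andP[bc cv]].
by rewrite gtn_max bc [x < c](allP ltxv _ cv) orbT.
Qed.

(** The two conditions say that the pattern is not decreasing and does not end with its maximum;
    132, 231 and 312 satisfy both. *)
Lemma vee_avoids u v d e f : pairwise ltn (u ++ v) -> d < e \/ e < f ->
  f < maxn d e -> avoids (rev u ++ v) [:: d; e; f].
Proof.
move=> Puv def fde q qp /same_relative_order3[a [b [c [qE ab bc ca]]]].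
rewrite qE in qp; have := vee_subseq3 Puv qp; lia.
Qed.

(** * Avoiding 132, 231 and 312 *)

Lemma avoids_subseq p q t : subseq p q -> avoids q t -> avoids p t.
Proof. by move=> pq avq r rp; apply: avq; exact: subseq_trans pq. Qed.

Lemma full_sorted_last_max q x :
  full_sorted (rcons q x) -> all (fun z => z < x) q.
Proof.
move qE: (rcons q x) => r fr; case: fr qE => [z|A a b B m _ _ _ lt_m].
  by case: q => // ? [].
rewrite -[a :: _]/([:: a, b & rcons B m]) -!rcons_cons -rcons_cat.
by case/rcons_inj=> -> ->.
Qed.

Lemma full_sorted_vee p : full_sorted p -> uniq p ->
  avoids p [:: 1; 3; 2] -> avoids p [:: 2; 3; 1] -> avoids p [:: 3; 1; 2] ->
  exists u v, [/\ p = rev u ++ v, pairwise ltn (u ++ v)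
                & size u = (size v).+1].
Proof.
elim=> {p} [x|A x y B n fA _ fB IHB yx lt_n] Up av132 av231 av312.
  by exists [:: x], [::].
case: A fA lt_n Up av132 av231 av312 => [|a A] fA lt_n Up av132 av231 av312;
  last first.
  (* A letter [a] before [x] would make [a x y] a 132 or a 231, as [x] exceeds both [a] and [y]. *)
  have ax : a < x by case/andP: (full_sorted_last_max fA).
  have ay : a != y.
    apply: contraTneq Up => ->.
    by rewrite /= negb_and negbK mem_cat !inE eqxx !orbT.
  have sub : subseq [:: a; x; y] ((a :: A) ++ x :: y :: rcons B n).
    rewrite -[(a :: A) ++ _]/([::] ++ a :: A ++ _).
    by do 2!apply: subseq_cons_cat; rewrite sub1seq mem_head.
  by have := avoids3 av132 sub; have := avoids3 av231 sub; move: ay => /=; lia.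
have subB : subseq (y :: B) (x :: y :: rcons B n).
  apply: subseq_trans (subseq_cons _ _).
  by rewrite -rcons_cons subseq_rcons.
have [u [v [yBE Puv szu]]] := IHB (subseq_uniq subB Up)
  (avoids_subseq subB av132) (avoids_subseq subB av231)
  (avoids_subseq subB av312).
case/lastP: u yBE Puv szu => // u y'; rewrite rev_rcons => -[yy' BE].
(* The new first letter [x] extends the decreasing run and [n] the increasing one. It remains to
   place [x] between [y] and [v]: a letter [z] of [v] below [x] would make [x y z] a 312. *)
subst y' B => Puv szu; exists (rcons (rcons u y) x), (rcons v n).
have pE : x :: y :: rcons (rev u ++ v) n
    = rev (rcons (rcons u y) x) ++ rcons v n.
  by rewrite !rev_rcons rcons_cat.
split; [exact: pE | | by rewrite size_rcons szu size_rcons].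
move: (Puv); rewrite pairwise_cat => /and3P[ltuv Pu Pv].
rewrite -rcons_cat -cats1 pairwise_cat allrel1r /= andbT; apply/andP; split.
  move: lt_n; rewrite /= !all_cat !all_rcons all_rev; case/and4P=> -> -> ->.
  by move->.
rewrite pairwise_cat -[rcons _ x]cats1 allrel_catl allrel1l ltuv Pv /=.
rewrite andbT pairwise_cat allrel1r Pu /= !andbT; apply/andP; split.
  apply/allP => z zv.
  have zB : z \in rcons (rev u ++ v) n.
    by rewrite mem_rcons inE mem_cat zv !orbT.
  have yz : y < z.
    by move: ltuv => /allrelP; apply=> //; rewrite mem_rcons mem_head.
  have zx : x != z.
    by apply: contraTneq Up => ->; rewrite /= inE zB orbT.
  have sub : subseq [:: x; y; z] (x :: y :: rcons (rev u ++ v) n).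
    by rewrite /= !eqxx sub1seq.
  by have := avoids3 av312 sub; move: zx => /=; lia.
rewrite all_rcons /= yx; apply: sub_all (pairwise_ltn_rcons Pu) => z zy.
exact: ltn_trans zy yx.
Qed.

(** * Avoiding 132 and 321 *)

(** Otherwise the left part contains a descent [a b] before its last letter [x]. Then [b x y] is a
    132 if [b < y], and [a b y] is a 321 if [y < b]. *)
Lemma full_sorted_prefix1 A x y B n : full_sorted (rcons A x) -> y < x ->
  uniq (A ++ x :: y :: rcons B n) ->
  avoids (A ++ x :: y :: rcons B n) [:: 1; 3; 2] ->
  avoids (A ++ x :: y :: rcons B n) [:: 3; 2; 1] -> A = [::].
Proof.
move qE: (rcons A x) => q fq; case: fq qE => [z|A1 a b B1 m _ _ ba].
  by case: A => // ? [].
move=> lt_m; rewrite -2!rcons_cons -rcons_cat => /rcons_inj[AE xm] yx.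
subst A m => U av132 av321.
have bx : b < x by move: lt_m; rewrite all_cat => /and4P[].
have subb : subseq [:: b; x; y] ((A1 ++ a :: b :: B1) ++ x :: y :: rcons B n).
  rewrite -catA cat_cons -cat_rcons.
  by do 2!apply: subseq_cons_cat; rewrite sub1seq mem_head.
have suba : subseq [:: a; b; y] ((A1 ++ a :: b :: B1) ++ x :: y :: rcons B n).
  rewrite -catA /=; apply: subseq_cons_cat.
  by rewrite /= eqxx sub1seq mem_cat !inE eqxx !orbT.
have yb : y != b.
  move: U; rewrite cat_uniq => /and3P[_ /hasPn/(_ y) + _].
  rewrite !inE eqxx orbT => /(_ isT); apply: contraNneq => ->.
  by rewrite /= mem_cat !inE eqxx !orbT.
by have := avoids3 av132 subb; have := avoids3 av321 suba; move: yb => /=; lia.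
Qed.

(** The left part is the single letter [x]. If the right part is not a single letter, its own left
    part is, so it begins with a descent [a b], and [x a b] is a 321. *)
Lemma full_sorted_size_le3 p : full_sorted p -> uniq p ->
  avoids p [:: 1; 3; 2] -> avoids p [:: 3; 2; 1] -> size p <= 3.
Proof.
case=> [//|A x y B n fA fB yx lt_n] U av132 av321.
have A0 := full_sorted_prefix1 fA yx U av132 av321; subst A.
move qE: (y :: B) fB => q fB; case: fB qE => [z [_ ->] //|].
move=> A1 a b B1 m fA1 _ ba _ yBE.
have sub : subseq (y :: B) (x :: y :: rcons B n).
  by apply: subseq_trans (subseq_cons _ _); rewrite -rcons_cons subseq_rcons.
have A10 : A1 = [::].
  apply: (full_sorted_prefix1 (B := B1) (n := m) fA1 ba); rewrite -yBE.
  - exact: subseq_uniq sub U.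
  - exact: avoids_subseq av132.
  - exact: avoids_subseq av321.
move: yBE; rewrite A10 /= => -[ya BE]; subst y B.
have sub3 : subseq [:: x; a; b] [:: x, a & rcons (b :: rcons B1 m) n].
  by rewrite /= !eqxx sub0seq.
by have := avoids3 av321 sub3 => /=; lia.
Qed.

(** * The enumeration *)

Fixpoint layered_perm (s k : nat) : seq nat :=
  if k is k'.+1 then s.+1 :: s :: layered_perm s.+2 k' else [:: s].

Lemma perm_layered_perm s k : perm_eq (layered_perm s k) (iota s (2 * k).+1).
Proof.
elim: k s => // k IH s; rewrite mulnS /=.
by rewrite -cat1s -[s :: layered_perm _ _]cat1s perm_catCA !perm_cons IH.
Qed.

Lemma layered_layered_perm s k : layered (layered_perm s k).
Proof.
elim: k s => [|k IH] s; first exact: layered1.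
apply: layered_cons => //; apply/allP => z.
by rewrite (perm_mem (perm_layered_perm _ _)) mem_iota; lia.
Qed.

Lemma perm_iota_is_permutation p m : perm_eq p (iota 1 m) -> is_permutation p.
Proof.
rewrite perm_sym => /is_permutation_perm; apply.
by split; [exact: iota_uniq | apply/allP => x; rewrite mem_iota => /andP[]].
Qed.

Lemma card_eq1 (X : set (seq nat)) p :
  X p -> (forall q, X q -> q = p) -> (X #= `I_1)%card.
Proof.
move=> Xp Xq; suff -> : X = [set p]%classic by exact: card_set1.
by apply/seteqP; split=> [q /Xq|q ->].
Qed.

Lemma uniquely_sorted_av_full k taus p :
  uniquely_sorted_av (2 * k + 1) taus p ->
  [/\ perm_eq p (iota 1 (2 * k).+1), full_sorted p, uniq p
    & forall tau, tau \in taus -> avoids p tau].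
Proof.
rewrite addn1 => -[pp us av]; split=> //.
  apply: uniquely_sorted_full us _.
  by rewrite -size_eq0 (perm_size pp) size_iota.
by case: (perm_iota_is_permutation pp).
Qed.

(** Covers three of the classes at once: the layered word avoids all three patterns, and 321 with
    either of the others already forces it. *)
Lemma card_uniquely_sorted_layered k taus :
  {subset taus <= [:: [:: 2; 3; 1]; [:: 3; 1; 2]; [:: 3; 2; 1]]} ->
  [:: 3; 2; 1] \in taus ->
  ([:: 2; 3; 1] \in taus) || ([:: 3; 1; 2] \in taus) ->
  (uniquely_sorted_av (2 * k + 1) taus #= `I_1)%card.
Proof.
move=> sub in321 in231; pose t := layered_perm 1 k.
have lt := layered_layered_perm 1 k; have pt := perm_layered_perm 1 k.
apply: (card_eq1 (p := t)) => [|p /uniquely_sorted_av_full[pp fp Up av]].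
  split; first by rewrite addn1.
    exact: layered_uniquely_sorted lt (perm_iota_is_permutation pt).
  by move=> tau /sub; rewrite !inE => /or3P[] /eqP->; exact: layered_avoids.
apply: layered_perm_inj => //; last by rewrite (permPl pp) perm_sym.
apply: full_sorted_layered => //; first exact: av.
by case/orP: in231 => /av; [left | right].
Qed.

Lemma card_uniquely_sorted_vee k :
  (uniquely_sorted_av (2 * k + 1)
     [:: [:: 1; 3; 2]; [:: 2; 3; 1]; [:: 3; 1; 2]] #= `I_1)%card.
Proof.
(* The word [rev u ++ v] is (k+1) k ... 1 (k+2) ... (2k+1). *)
pose u := iota 1 k.+1; pose v := iota k.+2 k.
have uvE : u ++ v = iota 1 (2 * k).+1.
  by rewrite /u /v -iotaD; congr iota; lia.
have puv : perm_eq (rev u ++ v) (iota 1 (2 * k).+1).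
  by rewrite -uvE perm_cat2r perm_rev.
have Puv : pairwise ltn (u ++ v).
  by rewrite uvE -(sorted_pairwise ltn_trans) iota_ltn_sorted.
apply: (card_eq1 (p := rev u ++ v)) =>
    [|p /uniquely_sorted_av_full[pp fp Up av]].
  split; first by rewrite addn1.
    apply: vee_uniquely_sorted => //; last by rewrite !size_iota.
    by rewrite uvE; apply/allP => x; rewrite mem_iota => /andP[].
  move=> tau; rewrite !inE => /or3P[] /eqP->; apply: vee_avoids => //.
  - by left.
  - by left.
  - by right.
have [|||u' [v' [pE Puv' szu']]] := full_sorted_vee fp Up; try exact: av.
have puv' : perm_eq (u' ++ v') (iota 1 (2 * k).+1).
  by rewrite -(permPr pp) pE perm_cat2r perm_sym perm_rev.
(* Both sides are increasing with the same letters; the lengths then fix where the decreasing run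
   stops. *)
have uvE' : u' ++ v' = u ++ v.
  apply: (sorted_eq (leT := leq)); first exact: leq_trans.
  - exact: anti_leq.
  - apply: (@sub_sorted _ ltn) => [x y /ltnW//|].
    by rewrite (sorted_pairwise ltn_trans).
  - by rewrite uvE iota_sorted.
  - by rewrite uvE.
have szuv' : size u' = size u.
  have := congr1 size uvE'; rewrite !size_cat szu' !size_iota; lia.
by move/eqP: uvE'; rewrite pE eqseq_cat // => /andP[/eqP-> /eqP->].
Qed.

Local Open Scope classical_set_scope.
Local Open Scope card_scope.

Theorem theorem10p1 :
  (forall k : nat,
     [/\ uniquely_sorted_av (2 * k + 1) [:: [:: 2; 3; 1]; [:: 3; 2; 1]] #= `I_1,
         uniquely_sorted_av (2 * k + 1) [:: [:: 3; 1; 2]; [:: 3; 2; 1]] #= `I_1,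
         uniquely_sorted_av (2 * k + 1) [:: [:: 2; 3; 1]; [:: 3; 1; 2]; [:: 3; 2; 1]] #= `I_1
       & uniquely_sorted_av (2 * k + 1) [:: [:: 1; 3; 2]; [:: 2; 3; 1]; [:: 3; 1; 2]] #= `I_1])
  /\
  (forall k : nat, 2 <= k ->
     uniquely_sorted_av (2 * k + 1) [:: [:: 1; 3; 2]; [:: 3; 2; 1]] = set0).
Proof.
split=> [k|k k2].
  split; last exact: card_uniquely_sorted_vee.
  - apply: card_uniquely_sorted_layered => // tau.
    by rewrite !inE => /orP[]->; rewrite ?orbT.
  - apply: card_uniquely_sorted_layered => // tau.
    by rewrite !inE => /orP[]->; rewrite ?orbT.
  - exact: card_uniquely_sorted_layered.
apply/seteqP; split=> // p /uniquely_sorted_av_full[pp fp Up av].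
(* The length 2k+1 is at least 5, above the bound 3. *)
have := full_sorted_size_le3 fp Up (av _ _) (av _ _).
rewrite (perm_size pp) size_iota !inE => /(_ isT isT); lia.
Qed.
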